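(* Let $G$ be a finite simple graph. Then $\sigma_{\mathbb{Z}_N}(G)\le\sigma_{\mathbb{T}}(G)$ for every $N\in\mathbb{N}$, and \[\sigma_{\mathbb{T}}(G)=\sup_{N\in\mathbb{N}}\sigma_{\mathbb{Z}_N}(G)=\lim_{N\to\infty}\sigma_{\mathbb{Z}_N}(G)\] (in particular, the limit exists).
   Context: Here $\mathbb{N}$ is the set of positive integers. For an abelian group $Z$ and a graph $G$, a set $A\subseteq Z$ is a coloring $Z$-base for $G$ if there exists a function $f:V(G)\to Z$ such that the sets $A+f(u)$ and $A+f(v)$ are disjoint for every edge $uv$ of $G$. For a compact abelian topological group $Z$ with Haar probability measure $\mu$, define $\sigma_Z(G)=\sup\{\mu(A): A \text{ is a Borel coloring } Z\text{-base for } G\}$. The group $\mathbb{T}=\mathbb{R}/\mathbb{Z}$ carries its Haar (Lebesgue) probability measure, and $\mathbb{Z}_N=\mathbb{Z}/N\mathbb{Z}$ carries the discrete topology and the uniform probability measure. *)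

(* Defs.v *)
From HB Require Import structures.
From mathcomp Require Import all_boot all_order all_algebra.
From mathcomp Require Import finmap generic_quotient ring_quotient.
From mathcomp Require Import all_classical all_reals all_analysis measurable_realfun.

Set Implicit Arguments.
Unset Strict Implicit.
Unset Printing Implicit Defensive.

Import Order.TTheory GRing.Theory Num.Theory numFieldNormedType.Exports.

Local Open Scope classical_set_scope.
Local Open Scope ring_scope.

(* Measurable types of the library are pointed; 0 serves as the point. *)
Definition pointed_group (Z : topologicalZmodType) : Type := Z.
HB.instance Definition _ (Z : topologicalZmodType) :=
  Choice.on (pointed_group Z).
HB.instance Definition _ (Z : topologicalZmodType) :=
  isPointed.Build (pointed_group Z) (0 : Z).

Definition borel (Z : topologicalZmodType) :=
  g_sigma_algebraType (@open Z : set (set (pointed_group Z))).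

Definition coloring_base (Z : zmodType) (V : finType) (e : rel V) (A : set Z) :=
  exists f : V -> Z, forall u v : V, e u v ->
    [set a + f u | a in A] `&` [set a + f v | a in A] = set0.

(* A translation-invariant Borel probability. The regularity clause of a Haar
   measure is omitted: it is automatic when Z is compact and metrizable, which
   is the case of R/Z and of finite discrete groups. *)
Record haar_probability (R : realType) (Z : topologicalZmodType) := HaarProbability {
  haar_measure :> probability (borel Z) R ;
  haar_invariant : forall (z : Z) (A : set (borel Z)), measurable A ->
    haar_measure [set a + z | a in (A : set Z)] = haar_measure A }.

Definition sigma (R : realType) (Z : topologicalZmodType)
    (mu : haar_probability R Z) (V : finType) (e : rel V) : \bar R :=
  ereal_sup [set mu A | A in
    [set A : set (borel Z) | measurable A /\ coloring_base e (A : set Z)]].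

(* Num.int_num_subdef is the predicate underlying the qualifier Num.int. *)
Definition integers (R : realType) : zmodClosed R :=
  GRing.ZmodClosed.clone R (@Num.int_num_subdef R) _.

Definition circle (R : realType) : Type := Quotient.quot (integers R).
HB.instance Definition _ (R : realType) := Quotient.on (circle R).
HB.instance Definition _ (R : realType) := GRing.Zmodule.on (circle R).
HB.instance Definition _ (R : realType) := ZmodQuotient.on (circle R).

Section circle_topology.
Context (R : realType).
Local Open Scope quotient_scope.
Local Notation T := (circle R).

Definition circle_pi (x : R) : T := \pi_T x.

(* Quotient topology on R/Z. *)
Definition circle_open (U : set T) : Prop := open (circle_pi @^-1` U).

Let circle_openT : circle_open setT.
Proof. by rewrite /circle_open preimage_setT; exact: openT. Qed.

Let circle_openI (U V : set T) :
  circle_open U -> circle_open V -> circle_open (U `&` V).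
Proof. exact: openI. Qed.

Let circle_open_bigU (I : Type) (f : I -> set T) :
  (forall i, circle_open (f i)) -> circle_open (\bigcup_i f i).
Proof.
by move=> fo; rewrite /circle_open preimage_bigcup; apply: bigcup_open => i _; exact: fo.
Qed.

HB.instance Definition _ := isOpenTopological.Build T
  circle_openT circle_openI circle_open_bigU.

Lemma circle_piD x y : circle_pi (x + y) = circle_pi x + circle_pi y.
Proof. exact: (raddfD (\pi_T : R -> T)). Qed.

Lemma circle_piB x y : circle_pi (x - y) = circle_pi x - circle_pi y.
Proof. exact: (raddfB (\pi_T : R -> T)). Qed.

Lemma circle_pi_eq x y : (circle_pi x = circle_pi y) <-> x - y \is a Num.int.
Proof.
have := @Quotient.idealrBE R (integers R) x y => E.
split => [/eqP|] h; first by rewrite -E in h.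
by apply/eqP; rewrite -E.
Qed.

Lemma circle_pi_surj (z : T) : exists x, circle_pi x = z.
Proof. by exists (repr z); rewrite /circle_pi reprK. Qed.

Lemma circle_pi_continuous : continuous circle_pi.
Proof. exact/continuousP. Qed.

Lemma circle_pi_open (U : set R) : open U -> open (circle_pi @` U).
Proof.
move=> oU; rewrite /open /= /circle_open.
rewrite (_ : _ @^-1` _ = \bigcup_(n : int) ((fun x => x - n%:~R) @^-1` U)).
  apply: bigcup_open => n _.
  by apply: open_comp => // x _; apply: cvgB; [exact: cvg_id|exact: cvg_cst].
apply/seteqP; split => [x [y Uy /circle_pi_eq /intrP[n yx]]|x [n _ Un]].
  by exists (- n) => //=; rewrite intrN opprK -yx addrC subrK.
exists (x - n%:~R) => //; apply/circle_pi_eq.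
by rewrite addrAC subrr add0r rpredN intr_int.
Qed.

Let circle_sub_continuous : continuous (fun x : T * T => x.1 - x.2).
Proof.
move=> [x y] W /=; rewrite (nbhsE (x - y)) => -[W1 [oW Wxy] W1W].
have [a ax] := circle_pi_surj x; have [b bx] := circle_pi_surj y.
have : nbhs ((a, b).1 - (a, b).2) (circle_pi @^-1` W1).
  by apply: open_nbhs_nbhs; split => //=; rewrite circle_piB ax bx.
move=> /(@sub_continuous R^o (a, b)) [[A B]] /= [].
rewrite (nbhsE a) (nbhsE b) => [[U [oU Ua] UA] [V [oV Vb] VB]] AB.
exists (circle_pi @` U, circle_pi @` V); first (split => /=).
- apply: open_nbhs_nbhs; split; first exact: circle_pi_open.
  by exists a.
- apply: open_nbhs_nbhs; split; first exact: circle_pi_open.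
  by exists b.
- move=> [_ _] /= [[u Uu <-] [v Vv <-]]; apply: W1W; rewrite -circle_piB.
  by apply: (AB (u, v)); split; [exact: UA|exact: VB].
Qed.

HB.instance Definition _ :=
  PreTopologicalNmodule_isTopologicalZmodule.Build T circle_sub_continuous.

End circle_topology.

Lemma circle_compact (R : realType) : compact [set: circle R].
Proof.
rewrite (_ : setT = @circle_pi R @` `[0, 1]).
  apply: continuous_compact; last exact: segment_compact.
  by apply: continuous_subspaceT; exact: circle_pi_continuous.
apply/seteqP; split => // z _; have [x <-] := circle_pi_surj z.
exists (x - (Num.floor x)%:~R).
  rewrite /= in_itv/= subr_ge0 floor_le_tmp /= lerBlDl.
  by rewrite ltW// -[1]/(1%:~R) -intrD; exact: floorD1_gt.
by apply/circle_pi_eq; rewrite addrAC subrr add0r rpredN intr_int.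
Qed.

Lemma lebesgue_measure_shift (R : realType) (c : R) (A : set R) : measurable A ->
  lebesgue_measure ((fun x => x + c) @^-1` A) = lebesgue_measure A.
Proof.
move=> mA.
have mc : measurable_fun setT ((fun x : R => x + c) : measurableTypeR R -> measurableTypeR R).
  apply: continuous_measurable_fun => x; apply: cvgD; [exact: cvg_id|exact: cvg_cst].
transitivity (pushforward lebesgue_measure
    ((fun x : R => x + c) : _ -> measurableTypeR R) A) => //.
apply/esym/lebesgue_measure_unique => //= _ [[a b]] _ <-; rewrite /pushforward.
rewrite (_ : _ @^-1` _ = `]a - c, b - c]%classic).
  rewrite !lebesgue_measure_itv/= !lte_fin ltrD2r; case: ifP => // _.
  by rewrite -!EFinB opprB addrA subrK.
by apply/seteqP; split => x /=; rewrite !in_itv/= ltrBlDr lerBrDr.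
Qed.

Section circle_haar.
Context (R : realType).
Local Notation T := (circle R).

Lemma measurable_circle_pi : measurable_fun [set: measurableTypeR R]
  (@circle_pi R : measurableTypeR R -> borel T).
Proof.
apply: (@measurability _ _ (measurableTypeR R) (borel T) _ _ (@open T)) => // _ [B oB <-].
rewrite setTI; apply: open_measurable; exact: oB.
Qed.

Let measurable_pi_preimage (A : set (borel T)) : measurable A ->
  measurable (@circle_pi R @^-1` A : set (measurableTypeR R)).
Proof.
by move=> mA; rewrite -[X in measurable X]setTI; exact: measurable_circle_pi.
Qed.

(* The image under R -> R/Z of the Lebesgue measure of [0, 1[. *)
Definition circle_measure (A : set (borel T)) : \bar R :=
  lebesgue_measure (@circle_pi R @^-1` A `&` `[0, 1[%classic).

Let circle_measure0 : circle_measure set0 = 0%E.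
Proof. by rewrite /circle_measure preimage_set0 set0I measure0. Qed.

Let circle_measure_ge0 A : (0 <= circle_measure A)%E.
Proof. exact: measure_ge0. Qed.

Let circle_measure_sigma_additive : semi_sigma_additive circle_measure.
Proof.
move=> F mF tF mUF; rewrite /circle_measure preimage_bigcup setI_bigcupl.
apply: measure_semi_sigma_additive.
- by move=> n; apply: measurableI => //; exact: measurable_pi_preimage.
- apply/trivIsetP => /= i j _ _ ij; rewrite setIACA -preimage_setI.
  by move/trivIsetP : tF => /(_ _ _ _ _ ij) ->//; rewrite preimage_set0 set0I.
- rewrite -setI_bigcupl -preimage_bigcup; apply: measurableI => //.
  exact: measurable_pi_preimage.
Qed.

HB.instance Definition _ := isMeasure.Build _ _ _ circle_measure
  circle_measure0 circle_measure_ge0 circle_measure_sigma_additive.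

Let circle_measureT : circle_measure setT = 1%E.
Proof.
rewrite /circle_measure preimage_setT setTI.
by rewrite lebesgue_measure_itv/= lte_fin ltr01 oppr0 adde0.
Qed.

HB.instance Definition _ :=
  Measure_isProbability.Build _ _ _ circle_measure circle_measureT.

Let lebesgue_split (B : set (measurableTypeR R)) (a b c : R) :
  measurable B -> a <= b -> b <= c ->
  lebesgue_measure (B `&` `[a, c[%classic) =
  (lebesgue_measure (B `&` `[a, b[%classic) +
   lebesgue_measure (B `&` `[b, c[%classic))%E.
Proof.
move=> mB ab bc; rewrite -measureU.
- rewrite -setIUr; congr (lebesgue_measure (B `&` _)).
  apply/seteqP; split => x /=; rewrite !in_itv/=.
    by move=> /andP[ax xc]; case: (ltP x b) => xb; [left|right]; apply/andP.
  by move=> [] /andP[h1 h2]; apply/andP; split => //;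
    [exact: lt_le_trans bc|exact: le_trans h1].
- exact: measurableI.
- exact: measurableI.
- apply/seteqP; split => // x [[_ /=]] + [_ /=]; rewrite !in_itv/=.
  by move=> /andP[_ xb] /andP[bx _]; move: (lt_le_trans xb bx); rewrite ltxx.
Qed.

Lemma circle_measure_invariant (z : T) (A : set (borel T)) : measurable A ->
  circle_measure [set a + z | a in (A : set T)] = circle_measure A.
Proof.
move=> mA; have [x xz] := circle_pi_surj z.
pose c := x - (Num.floor x)%:~R.
have cz : circle_pi c = z.
  by rewrite -xz; apply/circle_pi_eq; rewrite addrAC subrr add0r rpredN intr_int.
have c0 : 0 <= c by rewrite subr_ge0 floor_le_tmp.
have c1 : c <= 1.
  by rewrite lerBlDl ltW// -[1]/(1%:~R) -intrD; exact: floorD1_gt.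
have Nc0 : - c <= 0 by rewrite oppr_le0.
have c10 : 0 <= 1 - c by rewrite lerBrDr add0r.
have c11 : 1 - c <= 1 by rewrite gerBl.
have mB := measurable_pi_preimage mA.
set B := _ @^-1` _ in mB.
have BD1 y : B (y + 1) = B y.
  rewrite /B /preimage /=; congr (A _); apply/circle_pi_eq.
  by rewrite addrAC subrr add0r; exact: (intr_int _ 1).
rewrite /circle_measure.
have -> : @circle_pi R @^-1` [set a + z | a in (A : set T)] `&` `[0, 1[%classic =
    (fun y => y + (- c)) @^-1` (B `&` `[- c, 1 - c[%classic).
  apply/seteqP; split => [y [/= [a Aa az]]|y [/= By]]; rewrite !in_itv/=.
    move=> /andP[y0 y1]; split; last by rewrite lerDr y0 ltrD2r.
    by rewrite /B /= circle_piB cz -az addrK.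
  rewrite lerDr ltrD2r => y01; split => //=.
  by exists (circle_pi (y - c)) => //; rewrite circle_piB cz subrK.
rewrite lebesgue_measure_shift; last exact: measurableI.
rewrite -/B (lebesgue_split mB Nc0 c10) (lebesgue_split mB c10 c11).
rewrite addeC; congr (_ + _)%E.
rewrite -(lebesgue_measure_shift 1 (A := B `&` `[1 - c, 1[%classic)); last first.
  exact: measurableI.
congr lebesgue_measure; apply/seteqP; split => y /=; rewrite BD1 !in_itv/=.
  move=> [By /andP[h1 h2]]; split => //.
  by rewrite -lerBlDr addrAC subrr add0r h1 gtrDr.
move=> [By /andP[h1 h2]]; split => //; apply/andP; split.
  by move: h1; rewrite -lerBlDr addrAC subrr add0r.
by move: h2; rewrite gtrDr.
Qed.

Definition circle_haar : haar_probability R T :=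
  HaarProbability (haar_measure := circle_measure) circle_measure_invariant.

End circle_haar.

(* Z/NZ for N > 0, with the discrete topology; cyclic 0 is the trivial group,
   a junk value. *)
Definition cyclic (N : nat) : Type := discrete_topology 'I_N.-1.+1.
HB.instance Definition _ (N : nat) := DiscreteTopology.on (cyclic N).
HB.instance Definition _ (N : nat) := GRing.Zmodule.copy (cyclic N) 'I_N.-1.+1.
HB.instance Definition _ (N : nat) := Finite.copy (cyclic N) 'I_N.-1.+1.

Section cyclic_haar.
Context (R : realType) (N : nat).
Local Notation Z := (cyclic N).

Let cyclic_sub_continuous : continuous (fun x : Z * Z => x.1 - x.2).
Proof.
move=> [x y] W /= Wxy; exists ([set x], [set y]).
  by split; exact: discrete_set1.
by move=> [_ _] /= [-> ->]; exact: nbhs_singleton.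
Qed.

HB.instance Definition _ :=
  PreTopologicalNmodule_isTopologicalZmodule.Build Z cyclic_sub_continuous.

Lemma cyclic_compact : compact [set: Z].
Proof. by apply: finite_compact; exact: finite_finset. Qed.

Definition cyclic_measure (A : set (borel Z)) : \bar R :=
  (#|[pred x : Z | x \in A]|%:R / N.-1.+1%:R)%:E.

Let cyclic_measureE :
  cyclic_measure = mscale (N.-1.+1%:R^-1)%:nng (@counting (borel Z) R).
Proof.
apply/funext => A; have finA : finite_set (A : set Z) by exact: finite_finset.
rewrite /cyclic_measure /mscale /= mulrC EFinM.
have -> : @counting (borel Z) R A = (#|` fset_set (A : set Z) |%fset%:R)%:E.
  by rewrite /counting asboolT.
congr (_ * _%:R%:E)%E; rewrite cardE.
apply/perm_size/uniq_perm; [exact: enum_uniq|exact: fset_uniq|move=> x].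
by rewrite mem_enum /= in_fset_set.
Qed.

Let cyclic_measure0 : cyclic_measure set0 = 0%E.
Proof. by rewrite cyclic_measureE measure0. Qed.

Let cyclic_measure_ge0 A : (0 <= cyclic_measure A)%E.
Proof. by rewrite cyclic_measureE measure_ge0. Qed.

Let cyclic_measure_sigma_additive : semi_sigma_additive cyclic_measure.
Proof. by rewrite cyclic_measureE; exact: measure_semi_sigma_additive. Qed.

HB.instance Definition _ := isMeasure.Build _ _ _ cyclic_measure
  cyclic_measure0 cyclic_measure_ge0 cyclic_measure_sigma_additive.

Let cyclic_measureT : cyclic_measure setT = 1%E.
Proof.
rewrite /cyclic_measure (_ : #|_| = N.-1.+1) ?divff ?pnatr_eq0//.
rewrite -[RHS]card_ord; apply: eq_card => x.
by apply/idP; rewrite inE /= in_setT.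
Qed.

HB.instance Definition _ :=
  Measure_isProbability.Build _ _ _ cyclic_measure cyclic_measureT.

Lemma cyclic_measure_invariant (z : Z) (A : set (borel Z)) : measurable A ->
  cyclic_measure [set a + z | a in (A : set Z)] = cyclic_measure A.
Proof.
move=> _; congr (_%:R / _)%:E.
rewrite -(fintype.card_image (addIr z) [pred x : Z | x \in (A : set Z)]).
apply: eq_card => y; apply/idP/idP => [|/fintype.imageP[x]].
  rewrite inE /= => -[x Ax <-]; apply/fintype.imageP; exists x => //.
  by rewrite inE /=.
by rewrite inE /= => Ax ->; rewrite inE /=; exists x.
Qed.

Definition cyclic_haar : haar_probability R Z :=
  HaarProbability (haar_measure := cyclic_measure) cyclic_measure_invariant.

End cyclic_haar.

(* Main.v *)
(* Embedding: if A is a coloring base of Z_N with translations f, the union of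
   the open arcs ]a/N, (a + 1)/N[ for a in A has the same measure as A and is a
   coloring base of R/Z with translations f/N.
   Discretization: given a coloring base A of R/Z with translations F, take a
   compact K inside A of almost the same measure. By compactness, for every
   edge uv the set K - K + F u - F v stays at a positive distance from the
   integers, so for N large the cells [a/N, (a + 1)/N[ meeting K form a coloring
   base of Z_N with translations the integer parts of N F; these cells cover K,
   so the base has at least the measure of K. *)
Require Import Defs.
From HB Require Import structures.
From mathcomp Require Import all_boot all_order all_algebra.
From mathcomp Require Import all_classical all_reals all_analysis measurable_realfun.
From mathcomp Require Import ring lra.

Set Implicit Arguments.
Unset Strict Implicit.
Unset Printing Implicit Defensive.

Import Order.TTheory GRing.Theory Num.Theory numFieldNormedType.Exports.

Local Open Scope classical_set_scope.
Local Open Scope ring_scope.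

Lemma dist_int_gt0 (R : realType) (x : R) : x \isn't a Num.int ->
  exists2 r, 0 < r & forall k : int, r <= `|x - k%:~R|.
Proof.
move=> xint; have /andP[fx xf] := floor_itv x.
have fltx : (Num.floor x)%:~R < x.
  by rewrite lt_neqAle fx andbT; apply: contraNneq xint => <-; exact: intr_int.
exists (Num.min (x - (Num.floor x)%:~R) ((Num.floor x + 1)%:~R - x)).
  by rewrite lt_min !subr_gt0 fltx xf.
move=> k; rewrite ge_min; have [kf|fk] := leP k (Num.floor x).
  by rewrite ler_normr lerD2l lerN2 ler_int kf.
by rewrite orbC ler_normr opprB lerD2r ler_int lezD1 fk orbT.
Qed.

(** Around each [x] in [K], points within half the distance from [x] to the integers keep at least
    that half; compactness makes the resulting thresholds on [n] uniform. The bound shrinks like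
    [c / n.+1] because that is the size of the rounding errors it is compared with. *)
Lemma compact_dist_int (R : realType) (K : set R) (c : R) : compact K ->
  (forall x, K x -> x \isn't a Num.int) ->
  \forall n \near \oo, forall x, K x ->
    forall k : int, c / n.+1%:R <= `|x - k%:~R|.
Proof.
move=> /compact_near_coveringP cK Kint; apply: (cK nat \oo).
move=> x /Kint /dist_int_gt0[r r0 xr].
(* For such [n], [c / n.+1] is at most [r / 2]. *)
exists (ball x (r / 2), [set n | (Num.bound `|c / (r / 2)| <= n)%N]).
  by split => /=; [apply: nbhsx_ballx; rewrite divr_gt0|exact: nbhs_infty_ge].
move=> [y n] /= [xy cn] k; rewrite ler_pdivrMr//.
have cn1 : c <= r / 2 * n.+1%:R.
  rewrite mulrC -ler_pdivrMr ?divr_gt0//; apply: le_trans (ler_norm _) _.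
  rewrite ltW// (lt_le_trans (archi_boundP (normr_ge0 _)))//.
  by rewrite ler_nat leqW.
apply: (le_trans cn1); rewrite ler_wpM2r//.
have := xr k; move: xy; rewrite /ball /= => xy rk.
have := ler_distD y x k%:~R; lra.
Qed.

(** Addition in ['I_n.+1] is addition of representatives modulo [n.+1]. The congruence is expressed
    in [R] so that it combines with the real inequalities defining the cells. *)
Lemma ord_addE (R : realType) (n : nat) (i j k l : 'I_n.+1) :
  i + j = k + l <->
  exists m : int, i%:R + j%:R - (k%:R + l%:R) = m%:~R * n.+1%:R :> R.
Proof.
transitivity ((i + j)%N == (k + l)%N %[mod n.+1]).
  by split=> [/(congr1 val)/= /eqP //|/eqP h]; exact: val_inj.
rewrite -eqz_nat -!modz_nat eqz_mod_dvd.
split=> [/dvdzP[m] /(congr1 (fun z : int => z%:~R : R))|[m]].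
  by rewrite rmorphB rmorphM /= !PoszD !rmorphD; exists m.
rewrite -!natrD !pmulrn -intrB -intrM => /intr_inj h.
by apply/dvdzP; exists m.
Qed.

Lemma ord_truncn_itv (R : realType) (n : nat) (x : R) : 0 <= x < 1 ->
  exists i : 'I_n.+1, i%:R <= n.+1%:R * x < i%:R + 1.
Proof.
move=> /andP[x0 x1].
have Mx0 : 0 <= n.+1%:R * x by rewrite mulr_ge0.
have lt : (Num.truncn (n.+1%:R * x) < n.+1)%N.
  by rewrite truncn_lt_nat// gtr_pMr.
by exists (Ordinal lt) => /=; rewrite natr1; exact: truncn_itv.
Qed.

Lemma circle_pi_surj01 (R : realType) (z : circle R) :
  exists2 x, 0 <= x < 1 & circle_pi x = z.
Proof.
have [x <-] := circle_pi_surj z; have /andP[fx xf] := floor_itv x.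
exists (x - (Num.floor x)%:~R).
  by rewrite subr_ge0 fx /= ltrBlDl -[1]/(1%:~R) -intrD.
by apply/circle_pi_eq; rewrite addrAC subrr add0r rpredN intr_int.
Qed.

(* The Boolean b tells whether the left endpoint is included. *)
Definition cell (R : realType) (b : bool) (n : nat) (i : 'I_n.+1) : set R :=
  [set` Interval (BSide b (i%:R / n.+1%:R)) (BLeft (i.+1%:R / n.+1%:R))].

Lemma cellE (R : realType) (n : nat) (i : 'I_n.+1) (x : R) :
  cell true i x <-> i%:R <= n.+1%:R * x < i%:R + 1.
Proof.
by rewrite /cell /= in_itv /= ler_pdivrMr// ltr_pdivlMr// mulrC natr1.
Qed.

Lemma open_cellE (R : realType) (n : nat) (i : 'I_n.+1) (x : R) :
  cell false i x <-> i%:R < n.+1%:R * x < i%:R + 1.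
Proof.
by rewrite /cell /= in_itv /= ltr_pdivrMr// ltr_pdivlMr// mulrC natr1.
Qed.

Lemma int_lt1_eq (R : realType) (x y : R) :
  x \is a Num.int -> y \is a Num.int -> `|x - y| < 1 -> x = y.
Proof.
move=> xi yi xy1; apply/eqP; rewrite -subr_eq0.
by apply: contraTT xy1 => /(norm_intr_ge1 (rpredB xi yi)); rewrite -leNgt.
Qed.

Lemma sub_cell (R : realType) b n (i : 'I_n.+1) : cell b i `<=` @cell R true _ i.
Proof. by case: b => // x /open_cellE/andP[/ltW ix xi]; apply/cellE/andP. Qed.

Lemma measurable_cells (R : realType) (b : bool) (n : nat) (A : set 'I_n.+1) :
  measurable (\bigcup_(i in A) @cell R b n i : set (measurableTypeR R)).
Proof.
apply: fin_bigcup_measurable; first exact: finite_finset.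
by move=> i _; exact: measurable_itv.
Qed.

(** A point determines the index of its cell, so the cells are disjoint, and each has length
    [1 / n.+1], with or without its left endpoint. The value is the uniform measure of [A]. *)
Lemma lebesgue_measure_cells (R : realType) (b : bool) (n : nat) (A : set 'I_n.+1) :
  lebesgue_measure (\bigcup_(i in A) @cell R b n i) =
  (#|[pred i | i \in A]|%:R / n.+1%:R)%:E.
Proof.
transitivity
  (lebesgue_measure (\big[setU/set0]_(i < n.+1 | i \in A) @cell R b n i)).
  congr lebesgue_measure; rewrite -bigcup_seq_cond; apply: eq_bigcupl.
  by split=> i /=; rewrite mem_index_enum /= inE.
rewrite measure_bigsetU_ord.
- rewrite (eq_bigr (fun=> (n.+1%:R^-1)%:E)).
    by rewrite sumEFin sumr_const mulr_natl.
  move=> i _; apply: (etrans (lebesgue_measure_itv _)); rewrite /= lte_fin.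
  rewrite ltr_pM2r ?invr_gt0// ltr_nat ltnSn -EFinB -mulrBl -natrB//.
  by rewrite subSnn mul1r.
- by move=> i; exact: measurable_itv.
- apply/trivIsetP => i j _ _; apply: contraNeq => /set0P[x [ix jx]].
  move: ix jx => /sub_cell/cellE ix /sub_cell/cellE jx.
  apply/eqP/val_inj/eqP; rewrite -(eqr_nat R); apply/eqP.
  by apply: int_lt1_eq; rewrite ?natr_int// ltr_norml; lra.
Qed.

Lemma sigma_cyclic_le_circle (R : realType) (V : finType) (e : rel V) (N : nat) :
  (sigma (cyclic_haar R N) e <= sigma (circle_haar R) e)%E.
Proof.
apply: ge_ereal_sup => _ [A [mA [f fA]] <-].
(* Open cells make the image of [U] in the circle open, hence Borel. *)
set U := \bigcup_(i in A) @cell R false N.-1 i.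
have oU : open U by apply: bigcup_open => i _; exact: interval_open.
have mU : measurable (@circle_pi R @` U : set (borel (circle R))).
  by apply: sub_sigma_algebra; exact: circle_pi_open.
apply: (@le_trans _ _ (circle_haar R (@circle_pi R @` U))); last first.
  apply: ereal_sup_ubound; exists (@circle_pi R @` U) => //; split => //.
  exists (fun v => circle_pi ((f v : 'I_N.-1.+1)%:R / N.-1.+1%:R)) => u v euv.
  apply/seteqP; split => // z [[_ [x [i Ai ix] <-] <-] [_ [y [j Aj jy] <-]]].
  rewrite -!circle_piD => /circle_pi_eq/intrP[k yxk].
  (* A common point of the two translated arcs forces [i + f u = j + f v], against the disjointness
     given by [f]. *)
  have /seteqP[disj _] := fA _ _ euv; apply: (disj (i + f u)); split; first by exists i.
  exists j => //; apply/(ord_addE R); exists k; rewrite -yxk.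
  move: ix jy => /open_cellE ix /open_cellE jy.
  set M : R := N.-1.+1%:R in ix jy yxk *.
  have M0 : M != 0 by rewrite pnatr_eq0.
  have kM : (y + (f v)%:R / M - (x + (f u)%:R / M)) * M =
      M * y - M * x + ((f v)%:R - (f u)%:R) by field.
  (* The left side is an integer by [yxk], and the cells put it at distance less than 1 from
     [j - i]. *)
  suff : M * y - M * x = j%:R - i%:R by rewrite kM; lra.
  apply: int_lt1_eq.
  - have -> : M * y - M * x = k%:~R * M - ((f v)%:R - (f u)%:R).
      by rewrite -yxk kM; lra.
    by rewrite !(rpredB, rpredM)// ?intr_int ?natr_int.
  - by rewrite rpredB// natr_int.
  - by rewrite ltr_norml; lra.
rewrite /= /cyclic_measure -(lebesgue_measure_cells R false).
(* An inclusion suffices: [U] lies in [[0, 1[] and in the preimage of its own image. *)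
apply: le_measure; rewrite ?inE.
- exact: open_measurable.
- apply: measurableI => //; rewrite -[X in measurable X]setTI.
  exact: measurable_circle_pi.
- move=> x Ux; split; first by exists x.
  move: Ux => [i _ /open_cellE/andP[ix xi]].
  rewrite /= in_itv/=; apply/andP; split.
    by rewrite -(pmulr_rge0 _ (ltr0Sn R N.-1)) ltW// (le_lt_trans _ ix).
  by rewrite -(gtr_pMr _ (ltr0Sn R N.-1)) (lt_le_trans xi)// natr1 ler_nat.
Qed.

(** The loss [eps] comes only from passing to a compact subset; discretizing that subset loses no
    measure. *)
Lemma circle_haar_le_sigma_cyclic (R : realType) (V : finType) (e : rel V)
    (A : set (borel (circle R))) (eps : R) :
  measurable A -> coloring_base e (A : set (circle R)) -> 0 < eps ->
  \forall N \near \oo,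
    (circle_haar R A <= sigma (cyclic_haar R N) e + eps%:E)%E.
Proof.
move=> mA [f fA] eps0.
set B := @circle_pi R @^-1` A `&` `[0, 1[%classic.
have mB : measurable (B : set (measurableTypeR R)).
  apply: measurableI => //; rewrite -[X in measurable X]setTI.
  exact: measurable_circle_pi.
have Boo : (lebesgue_measure B < +oo)%E.
  by rewrite (le_lt_trans (probability_le1 (circle_haar R) mA)) ?ltry.
have [K [cK KB KBe]] := lebesgue_regularity_inner mB Boo eps0.
have mK : measurable (K : set (measurableTypeR R)) by exact: compact_measurable.
(* Representatives in [[0, 1[] make the integer part of [N.+1 * F v] an element of ['I_N.+1]. *)
have /choice[F F01] : forall v, exists x : R, 0 <= x < 1 /\ circle_pi x = f v.
  by move=> v; have [x x01 xf] := circle_pi_surj01 (f v); exists x.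
pose D u v := (fun p : R * R => p.1 - p.2 + (F u - F v)) @` (K `*` K).
have cD u v : compact (D u v).
  apply: continuous_compact; last exact: compact_setX.
  apply: continuous_subspaceT => p; apply: cvgD; last exact: cvg_cst.
  by apply: cvgB; [exact: cvg_fst|exact: cvg_snd].
have Dint u v : e u v -> forall x, D u v x -> x \isn't a Num.int.
  move=> euv _ [[x y] /= [Kx Ky] <-]; apply/negP => xyint.
  have /seteqP[disj _] := fA _ _ euv; apply: (disj (circle_pi (x + F u))); split.
    exists (circle_pi x); first by have [] := KB _ Kx.
    by rewrite circle_piD (F01 u).2.
  exists (circle_pi y); first by have [] := KB _ Ky.
  rewrite -(F01 v).2 -circle_piD; apply/esym/circle_pi_eq.
  by rewrite opprD addrACA.
(* The constant 2 covers four roundings, of two points and two translations: each is off by less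
   than one cell, and they enter in pairs of opposite sign. *)
have sep : \forall n \near \oo, forall u v, e u v -> forall x, D u v x ->
    forall k : int, 2 / n.+1%:R <= `|x - k%:~R|.
  apply: filter_forall => u; apply: filter_forall => v.
  case euv: (e u v); last by near=> n.
  near=> n => _; near: n; apply: compact_dist_int => //; exact: Dint.
(* [sep] at [n] concerns the group of order [n.+1], hence the shifted threshold, which also excludes
   [N = 0]. *)
case: sep => n0 _ sep; exists n0.+1 => // -[//|N] /= n0N.
have {}sep := sep N n0N.
have /choice[g gF] v := ord_truncn_itv N (F01 v).1.
pose AN : set (cyclic N.+1) := [set i : 'I_N.+1 | exists2 x, K x & cell true i x].
apply: (@le_trans _ _ (lebesgue_measure K + eps%:E)%E).
  rewrite [leLHS](_ : _ = lebesgue_measure K + lebesgue_measure (B `\` K))%E.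
    by rewrite leeD2l// ltW.
  rewrite -measureU//.
  - by rewrite setDUK.
  - exact: measurableD.
  - by rewrite setDIK.
rewrite leeD2r//; apply: (@le_trans _ _ (cyclic_haar R N.+1 AN)); last first.
  apply: ereal_sup_ubound; exists AN => //; split.
    by apply: sub_sigma_algebra; exact: discrete_open.
  exists g => u v euv.
  apply/seteqP; split => // z [[i [x Kx ix] <-] [j [y Ky jy]]].
  move=> /(ord_addE R)[k yxk].
  have Dxy : D u v (x - y + (F u - F v)) by exists (x, y).
  have := sep _ _ euv _ Dxy (- k).
  rewrite leNgt => /negP; apply.
  move: ix jy (gF u) (gF v) => /cellE ix /cellE jy gu gv.
  set M : R := N.+1%:R in ix jy gu gv yxk *.
  have M0 : 0 < M by rewrite ltr0n.
  rewrite ltr_pdivlMr// -[X in _ * X](gtr0_norm M0) -normrM ltr_norml.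
  rewrite mulrNz opprK.
  have -> : (x - y + (F u - F v) + k%:~R) * M =
      M * x - M * y + (M * F u - M * F v) + k%:~R * M by ring.
  by rewrite -yxk; lra.
rewrite /= /cyclic_measure -(lebesgue_measure_cells R true).
apply: le_measure; rewrite ?inE//; first exact: measurable_cells.
(* The half-open cells cover [[0, 1[], so every point of [K] lies in a selected one. *)
move=> x Kx; have /(ord_truncn_itv N)[i /cellE ix]: 0 <= x < 1.
  by have [_] := KB _ Kx; rewrite /= in_itv.
by exists i => //; exists x.
Unshelve. all: by end_near.
Qed.

(** The empty set is a coloring base and probabilities are at most 1, so the supremum lies between 0
    and 1. *)
Lemma sigma_fin_num (R : realType) (Z : topologicalZmodType)
    (mu : haar_probability R Z) (V : finType) (e : rel V) :
  sigma mu e \is a fin_num.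
Proof.
rewrite ge0_fin_numE.
  apply: (@le_lt_trans _ _ 1%E); last exact: ltry.
  by apply: ge_ereal_sup => _ [A [mA _] <-]; exact: probability_le1.
apply: ereal_sup_ubound; exists set0; last exact: measure0.
by split => //; exists (fun=> 0) => u v _; rewrite image_set0 set0I.
Qed.

Theorem theorem2 (R : realType) (V : finType) (e : rel V)
    (e_sym : symmetric e) (e_irr : irreflexive e) :
  [/\ forall N : nat, (0 < N)%N ->
        (sigma (cyclic_haar R N) e <= sigma (circle_haar R) e)%E,
      sigma (circle_haar R) e =
        ereal_sup [set sigma (cyclic_haar R N) e | N in [set N | (0 < N)%N]] &
      sigma (cyclic_haar R N) e @[N --> \oo] --> sigma (circle_haar R) e].
Proof.
(* Half of [eps] pays for a nearly optimal base of the circle, half for its discretization. *)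
have near_sup (eps : R) : 0 < eps -> \forall N \near \oo,
    (sigma (circle_haar R) e <= sigma (cyclic_haar R N) e + eps%:E)%E.
  move=> eps0; have eps20 : 0 < eps / 2 by rewrite divr_gt0.
  have [_ [A [mA cA] <-] supA] :=
    ub_ereal_sup_adherent eps20 (sigma_fin_num (circle_haar R) e).
  apply: filterS (circle_haar_le_sigma_cyclic mA cA eps20) => N AN.
  rewrite [eps]splitr EFinD addeA -leeBlDr//.
  exact: le_trans (ltW supA) AN.
split=> [N _||]; first exact: sigma_cyclic_le_circle.
- apply/eqP; rewrite eq_le; apply/andP; split.
    apply/lee_addgt0Pr => eps /near_sup[N _ supN].
    (* [N.+1] is beyond the threshold and positive even when the threshold is 0. *)
    apply: le_trans (supN N.+1 _) _; first exact: leqnSn.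
    by rewrite leeD2r//; apply: ereal_sup_ubound; exists N.+1.
  by apply: ge_ereal_sup => _ [N _ <-]; exact: sigma_cyclic_le_circle.
- have sT := sigma_fin_num (circle_haar R) e.
  rewrite -(fineK sT); apply/fine_cvgP; split.
    by apply: nearW => N; exact: sigma_fin_num.
  (* Squeeze: [near_sup] bounds the sequence from below, the embedding from above. *)
  apply/cvgrPdist_le => eps /near_sup; apply: filterS => N supN /=.
  have := sigma_cyclic_le_circle R e N; move: supN.
  rewrite -(fineK sT).
  rewrite -(fineK (sigma_fin_num (cyclic_haar R N) e)) -EFinD !lee_fin.
  by move=> supN Nsup; rewrite ler_norml; lra.
Qed.
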